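(* Let $\langle x\rangle,\langle y\rangle\in\mathrm{P}C$. Then: 1. $\langle x\rangle$ and $\langle y\rangle$ are at most one roll away if and only if $xy=0$, or equivalently, if and only if $x\times y=0$. 2. $\langle x\rangle$ and $\langle y\rangle$ are at most two rolls away if and only if $x\cdot y=0$. 3. $\langle x\rangle$ and $\langle y\rangle$ are always at most three rolls away.
   Context: $\mathbb{H}$ denotes the quaternions. The split octonions $\mathbb{O}'$ are the real vector space $\mathbb{H}\oplus\mathbb{H}$ with product $(a,b)(c,d)=(ac+d\overline{b},\,\overline{a}d+cb)$, conjugation $\overline{(a,b)}=(\overline{a},-b)$ and quadratic form $Q(a,b)=|a|^2-|b|^2$. The imaginary split octonions are $\mathbb{I}=\{x\in\mathbb{O}':\overline{x}=-x\}=\mathrm{Im}(\mathbb{H})\oplus\mathbb{H}$. The dot product is the symmetric bilinear form with $x\cdot x=Q(x)$; on $\mathbb{I}$ it satisfies $x\cdot y=-\tfrac12(xy+yx)$ (real multiples of $1$ identified with reals). The cross product on $\mathbb{I}$ is $x\times y=\tfrac12(xy-yx)$, so $xy=x\times y-x\cdot y$. Let $C=\{x\in\mathbb{I}:Q(x)=0\}$ and $\mathrm{P}C=\{x\in C:x\neq0\}/\mathbb{R}^*$; $\langle x\rangle\in\mathrm{P}C$ is the point spanned by a nonzero $x\in C$. A null subalgebra of $\mathbb{O}'$ is a linear subspace $V$ with $xy=0$ for all $x,y\in V$ (then $V\subset C$). A line in $\mathrm{P}C$ is the projectivization of a 2-dimensional null subalgebra. Two points $a,b$ are at most $n$ rolls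 away if there is a sequence of points $a_0,\dots,a_n$ with $a_0=a$, $a_n=b$ such that for any two consecutive points there is a line containing both of them. *)

(* Defs.v *)
From HB Require Import structures.
From mathcomp Require Import all_boot all_order all_algebra.
From mathcomp Require Import boolp classical_sets reals.
From mathcomp Require Import ring lra.

Set Implicit Arguments.
Unset Strict Implicit.
Unset Printing Implicit Defensive.

Import Order.TTheory GRing.Theory Num.Theory.

Local Open Scope classical_set_scope.
Local Open Scope ring_scope.

Declare Scope splitoct_scope.
Delimit Scope splitoct_scope with splitoct.

(* Row vectors of coordinates in the basis 1, i, j, k; the alias carries the
   Hamilton product. *)
Definition quat (R : realType) : Type := 'rV[R]_4.

HB.instance Definition _ (R : realType) := Vector.copy (quat R) 'rV[R]_4.

Definition mkquat (R : realType) (a b c d : R) : quat R :=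
  \row_(i < 4) [:: a; b; c; d]`_i.

Definition qcoord (R : realType) (i : nat) (q : quat R) : R :=
  (q : 'rV[R]_4) 0 (inord i).

Definition qone (R : realType) : quat R := mkquat 1 0 0 0.

Definition qmul (R : realType) (p q : quat R) : quat R :=
  let a1 := qcoord 0 p in let b1 := qcoord 1 p in
  let c1 := qcoord 2 p in let d1 := qcoord 3 p in
  let a2 := qcoord 0 q in let b2 := qcoord 1 q in
  let c2 := qcoord 2 q in let d2 := qcoord 3 q in
  mkquat (a1 * a2 - b1 * b2 - c1 * c2 - d1 * d2)
         (a1 * b2 + b1 * a2 + c1 * d2 - d1 * c2)
         (a1 * c2 - b1 * d2 + c1 * a2 + d1 * b2)
         (a1 * d2 + b1 * c2 - c1 * b2 + d1 * a2).

Definition qconj (R : realType) (q : quat R) : quat R :=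
  mkquat (qcoord 0 q) (- qcoord 1 q) (- qcoord 2 q) (- qcoord 3 q).

Definition qnormsq (R : realType) (q : quat R) : R :=
  qcoord 0 q ^+ 2 + qcoord 1 q ^+ 2 + qcoord 2 q ^+ 2 + qcoord 3 q ^+ 2.

Section QuatTheory.
Variable R : realType.
Implicit Types (p q r : quat R) (k : R).

Lemma quatP p q :
  [/\ qcoord 0 p = qcoord 0 q, qcoord 1 p = qcoord 1 q,
      qcoord 2 p = qcoord 2 q & qcoord 3 p = qcoord 3 q] -> p = q.
Proof.
case=> h0 h1 h2 h3; apply/rowP=> i.
by rewrite -(inord_val i); case: i => -[|[|[|[|]]]].
Qed.

Lemma qcoord_mk (a b c d : R) :
  ((qcoord 0 (mkquat a b c d) = a) * (qcoord 1 (mkquat a b c d) = b) *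
   (qcoord 2 (mkquat a b c d) = c) * (qcoord 3 (mkquat a b c d) = d))%type.
Proof. by rewrite /qcoord !mxE !inordK. Qed.

Lemma qcoordD i p q : qcoord i (p + q) = qcoord i p + qcoord i q.
Proof. by rewrite /qcoord mxE. Qed.

Lemma qcoordN i p : qcoord i (- p) = - qcoord i p.
Proof. by rewrite /qcoord mxE. Qed.

Lemma qcoordZ i k p : qcoord i (k *: p) = k * qcoord i p.
Proof. by rewrite /qcoord mxE. Qed.

Lemma qcoord0 i : qcoord i (0 : quat R) = 0.
Proof. by rewrite /qcoord mxE. Qed.

Definition qcoordE := (qcoord_mk, qcoordD, qcoordN, qcoordZ, qcoord0).

Lemma qmulA : associative (@qmul R).
Proof. by move=> p q r; apply: quatP; rewrite !qcoordE; split; ring. Qed.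

Lemma qmul1q : left_id (qone R) (@qmul R).
Proof. by move=> p; apply: quatP; rewrite !qcoordE; split; ring. Qed.

Lemma qmulq1 : right_id (qone R) (@qmul R).
Proof. by move=> p; apply: quatP; rewrite !qcoordE; split; ring. Qed.

Lemma qmulDl : left_distributive (@qmul R) +%R.
Proof. by move=> p q r; apply: quatP; rewrite !qcoordE; split; ring. Qed.

Lemma qmulDr : right_distributive (@qmul R) +%R.
Proof. by move=> p q r; apply: quatP; rewrite !qcoordE; split; ring. Qed.

Lemma qone_neq0 : qone R != 0.
Proof.
by apply/eqP=> /(congr1 (qcoord 0)); rewrite !qcoordE => /eqP; rewrite oner_eq0.
Qed.

End QuatTheory.

HB.instance Definition _ (R : realType) :=
  GRing.Zmodule_isNzRing.Build (quat R) (@qmulA R) (@qmul1q R) (@qmulq1 R)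
    (@qmulDl R) (@qmulDr R) (@qone_neq0 R).

(* MathComp equips pairs of rings with the componentwise product; the split
   octonion product is [omul], written [x ** y], and never [x * y]. *)
Definition splitoct (R : realType) : Type := (quat R * quat R)%type.

HB.instance Definition _ (R : realType) :=
  Vector.copy (splitoct R) (quat R * quat R)%type.

Definition omul (R : realType) (x y : splitoct R) : splitoct R :=
  (x.1 * y.1 + y.2 * qconj x.2, qconj x.1 * y.2 + y.1 * x.2).

Notation "x ** y" := (omul x y) (at level 40, left associativity) :
  splitoct_scope.
Local Open Scope splitoct_scope.

Definition oone (R : realType) : splitoct R := (1, 0).

Definition oconj (R : realType) (x : splitoct R) : splitoct R :=
  (qconj x.1, - x.2).

Definition oQ (R : realType) (x : splitoct R) : R :=
  qnormsq x.1 - qnormsq x.2.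

(* Polarization of [oQ]. *)
Definition odot (R : realType) (x y : splitoct R) : R :=
  (oQ (x + y) - oQ x - oQ y) / 2.

Definition ocross (R : realType) (x y : splitoct R) : splitoct R :=
  2^-1 *: (x ** y - y ** x).

Definition imag_oct (R : realType) : set (splitoct R) :=
  [set x | oconj x = - x].

Definition null_cone (R : realType) : set (splitoct R) :=
  [set x | imag_oct x /\ oQ x = 0].

(* Projective points are the equivalence classes, i.e. the orbits of nonzero
   vectors under scaling by nonzero reals. *)
Definition proj_pt (R : realType) (x : splitoct R) : set (splitoct R) :=
  [set y | exists2 k : R, k != 0 & y = k *: x].

Definition projectivization (R : realType) (A : set (splitoct R)) :
    set (set (splitoct R)) :=
  [set p | exists x, [/\ A x, x != 0 & p = proj_pt x]].

Definition PC (R : realType) : set (set (splitoct R)) :=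
  projectivization (@null_cone R).

Definition null_subalgebra (R : realType) (V : {vspace splitoct R}) : Prop :=
  forall x y, x \in V -> y \in V -> x ** y = 0.

Definition PC_line (R : realType) (L : set (set (splitoct R))) : Prop :=
  exists V : {vspace splitoct R},
    [/\ null_subalgebra V, \dim V = 2%N & L = projectivization [set` V]].

Definition at_most_rolls_away (R : realType) (n : nat)
    (p q : set (splitoct R)) : Prop :=
  exists a : nat -> set (splitoct R),
    [/\ a 0%N = p, a n = q,
        forall i, (i <= n)%N -> PC (a i) &
        forall i, (i < n)%N ->
          exists L, [/\ PC_line L, L (a i) & L (a i.+1)]].

Section SplitOctTheory.
Variable R : realType.
Implicit Types (x y z : splitoct R) (k : R).

Let o1D x y : (x + y).1 = x.1 + y.1. Proof. by []. Qed.
Let o2D x y : (x + y).2 = x.2 + y.2. Proof. by []. Qed.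
Let o1N x : (- x).1 = - x.1. Proof. by []. Qed.
Let o2N x : (- x).2 = - x.2. Proof. by []. Qed.
Let o1Z k x : (k *: x).1 = k *: x.1. Proof. by []. Qed.
Let o2Z k x : (k *: x).2 = k *: x.2. Proof. by []. Qed.
Let quat_mulE (p q : quat R) : p * q = qmul p q. Proof. by []. Qed.
Let octE := (o1D, o2D, o1N, o2N, o1Z, o2Z, quat_mulE).

Lemma odotxx x : odot x x = oQ x.
Proof. by rewrite /odot /oQ /qnormsq !octE !qcoordE; field. Qed.

Lemma odotC x y : odot x y = odot y x.
Proof. by rewrite /odot [x + y]addrC addrAC. Qed.

Lemma odot_linear y k x z : odot (k *: x + z) y = k * odot x y + odot z y.
Proof. by rewrite /odot /oQ /qnormsq !octE !qcoordE; field. Qed.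

Lemma imag_octP x : imag_oct x <-> qcoord 0 x.1 = 0.
Proof.
split=> [|x0].
  move/(congr1 (fun z : splitoct R => qcoord 0 z.1)).
  by rewrite /oconj /= !qcoordE; lra.
congr (_, _) => /=; apply: quatP.
by rewrite ?octE !qcoordE x0 oppr0.
Qed.

Lemma omul_sym_imag x y : imag_oct x -> imag_oct y ->
  - (2^-1 *: (x ** y + y ** x)) = odot x y *: oone R.
Proof.
move=> /imag_octP x0 /imag_octP y0.
congr (_, _); apply: quatP;
  rewrite /odot /oQ /qnormsq ?octE /= ?octE /qone ?qcoordE ?x0 ?y0;
  split; by field.
Qed.

Lemma omul_imag x y : imag_oct x -> imag_oct y ->
  x ** y = ocross x y - odot x y *: oone R.
Proof.
move=> ix iy; rewrite -omul_sym_imag // opprK -scalerDr addrACA addNr addr0.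
by rewrite -mulr2n -scaler_nat scalerA mulVf ?scale1r // pnatr_eq0.
Qed.

End SplitOctTheory.

(* Main.v *)
Require Import Defs.
From mathcomp Require Import all_boot all_order all_algebra.
From mathcomp Require Import boolp classical_sets reals.
From mathcomp Require Import ring lra.
Import Order.TTheory GRing.Theory Num.Theory.
Local Open Scope classical_set_scope.
Local Open Scope ring_scope.
Local Open Scope splitoct_scope.

Set Implicit Arguments.
Unset Strict Implicit.
Unset Printing Implicit Defensive.

(** A roll is a relation on vectors: for nonzero null vectors [x] and [y], some
    line contains both points exactly when [x ** y = 0] ([one_rollP]). If the
    points differ, the line is the plane spanned by [x] and [y]; if they
    coincide, a line through [x] is still required, and [null_annihilator]
    supplies a null vector [u], not proportional to [x], with [x ** u = 0].

    The algebra behind everything is that the split octonions form an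
    alternative composition algebra: [Q] is multiplicative, and for imaginary
    [x] both [x (x y)] and [(y x) x] equal [- Q(x) y]. For null [x], left and
    right multiplication by [x] therefore square to zero. The scalar part of a
    product of imaginary elements is minus their dot product.

    Two rolls. If [x y] is nonzero and [x] is orthogonal to [y], the vector
    [x y] is imaginary and null, and [x (x y) = 0 = (x y) y], so the point it
    spans is an intermediate stop. Conversely, let [z] span an intermediate
    stop, so that [x z = 0 = z y] and [x . z = 0 = y . z]. The polarized identity [x (z y) + z (x y) = - 2 (x . z) y] shows that [z]
    kills both [x y] and [y x], hence also their sum, which is the scalar
    [- 2 (x . y)]; since [z] is nonzero, [x . y = 0].

    Three rolls. When [x . y] is nonzero, [x] and [u] span a plane of null
    vectors annihilated by [x], and this plane meets the hyperplane orthogonal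
    to [y] in a line; rolling first from [x] to a point of that line leaves two
    rolls to do. *)

(** * Multiplication in the split octonions *)

Section SplitOctAlgebra.
Variable R : realType.
Implicit Types (x y z w u : splitoct R) (k : R).

Let o1D x y : (x + y).1 = x.1 + y.1. Proof. by []. Qed.
Let o2D x y : (x + y).2 = x.2 + y.2. Proof. by []. Qed.
Let o1N x : (- x).1 = - x.1. Proof. by []. Qed.
Let o2N x : (- x).2 = - x.2. Proof. by []. Qed.
Let o1Z k x : (k *: x).1 = k *: x.1. Proof. by []. Qed.
Let o2Z k x : (k *: x).2 = k *: x.2. Proof. by []. Qed.
Let quat_mulE (p q : quat R) : p * q = qmul p q. Proof. by []. Qed.
Let octE := (o1D, o2D, o1N, o2N, o1Z, o2Z, quat_mulE).

Lemma splitoctP x y : x.1 = y.1 -> x.2 = y.2 -> x = y.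
Proof. by case: x y => [a b] [c d] /= -> ->. Qed.

Ltac quat_coords :=
  apply: quatP; rewrite /qconj /qnormsq ?quat_mulE ?/qmul ?/qone ?qcoordE;
  split; ring.

(** The ring and vector space structures of the quaternions are declared
    separately, so their compatibility is a statement to prove. *)
Lemma qmulZl k (p q : quat R) : (k *: p) * q = k *: (p * q).
Proof. by quat_coords. Qed.

Lemma qmulZr k (p q : quat R) : p * (k *: q) = k *: (p * q).
Proof. by quat_coords. Qed.

Lemma qconjD (p q : quat R) : qconj (p + q) = qconj p + qconj q.
Proof. by quat_coords. Qed.

Lemma qconjN (p : quat R) : qconj (- p) = - qconj p.
Proof. by quat_coords. Qed.

Lemma qconjZ k (p : quat R) : qconj (k *: p) = k *: qconj p.
Proof. by quat_coords. Qed.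

Lemma qconjK (p : quat R) : qconj (qconj p) = p.
Proof. by quat_coords. Qed.

Lemma qconjM (p q : quat R) : qconj (p * q) = qconj q * qconj p.
Proof. by quat_coords. Qed.

Lemma qmul_conjr (p : quat R) : p * qconj p = qnormsq p *: (1 : quat R).
Proof. by quat_coords. Qed.

Lemma qmul_conjl (p : quat R) : qconj p * p = qnormsq p *: (1 : quat R).
Proof. by quat_coords. Qed.

Lemma omulDl x y z : (x + y) ** z = x ** z + y ** z.
Proof.
by apply: splitoctP; rewrite /= qconjD (mulrDl, mulrDr) mulrDr addrACA.
Qed.

Lemma omulDr x y z : x ** (y + z) = x ** y + x ** z.
Proof.
by apply: splitoctP; rewrite /= mulrDl mulrDr addrACA.
Qed.

Lemma omulZl k x y : (k *: x) ** y = k *: (x ** y).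
Proof.
by apply: splitoctP; rewrite /= qconjZ !(qmulZl, qmulZr) scalerDr.
Qed.

Lemma omulZr k x y : x ** (k *: y) = k *: (x ** y).
Proof.
by apply: splitoctP; rewrite /= !(qmulZl, qmulZr) scalerDr.
Qed.

Lemma omulo0 x : x ** 0 = 0.
Proof. by rewrite -(scale0r 0) omulZr !scale0r. Qed.

Lemma omul0o x : 0 ** x = 0.
Proof. by rewrite -(scale0r 0) omulZl !scale0r. Qed.

Ltac oct_coords :=
  rewrite /omul /odot /oQ /qnormsq /qconj ?octE /= ?octE /qmul ?qcoordE.

Lemma omulo1 x : x ** oone R = x.
Proof.
by apply: splitoctP; rewrite /= (mulr1, mulr0) ?mul0r ?mul1r ?addr0 ?add0r.
Qed.

Lemma oQ_omul x y : oQ (x ** y) = oQ x * oQ y.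
Proof. by oct_coords; ring. Qed.

Lemma imag_octD x y : imag_oct x -> imag_oct y -> imag_oct (x + y).
Proof.
move=> /imag_octP x0 /imag_octP y0; apply/imag_octP.
by rewrite octE qcoordE x0 y0 addr0.
Qed.

Lemma imag_octZ k x : imag_oct x -> imag_oct (k *: x).
Proof. by move=> /imag_octP x0; apply/imag_octP; rewrite octE qcoordE x0 mulr0. Qed.

(** Alternativity, in the form valid for every [x]: in the expansion the mixed
    terms cancel and the two remaining ones carry the central factors
    [a^* a = |a|^2] and [b b^* = |b|^2]. *)
Lemma omul_conjKl x y : oconj x ** (x ** y) = oQ x *: y.
Proof.
case: x y => [a b] [c d]; apply: splitoctP; rewrite /omul /oQ /= ?qconjN ?qconjK.
  rewrite mulrDr mulrDl !mulrN -!mulrA mulrA qmul_conjl qmul_conjr.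
  by rewrite scalerBl qmulZl mul1r qmulZr mulr1 addrA addrK.
rewrite mulrDr mulrDl !mulrN -!mulrA mulrA qmul_conjr qmul_conjl.
by rewrite scalerBl qmulZl mul1r qmulZr mulr1 addrA addrK.
Qed.

Lemma omul_conjKr x y : (y ** x) ** oconj x = oQ x *: y.
Proof.
case: x y => [a b] [c d]; apply: splitoctP; rewrite /omul /oQ /=.
  rewrite mulNr qconjD !qconjM qconjK mulrDl mulrDr opprD -!mulrA.
  rewrite qmul_conjr [b * (_ * c)]mulrA qmul_conjr.
  by rewrite addrACA addrN addr0 qmulZl mul1r qmulZr mulr1 scalerBl.
rewrite mulrN qconjD !qconjM qconjK mulrDl mulrDr opprD -!mulrA.
rewrite qmul_conjl [_ * (a * d)]mulrA qmul_conjl.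
by rewrite addrACA addNr add0r qmulZl mul1r qmulZr mulr1 scalerBl addrC.
Qed.

Lemma omulNl x y : (- x) ** y = - (x ** y).
Proof. by rewrite -!scaleN1r omulZl. Qed.

Lemma omulNr x y : x ** (- y) = - (x ** y).
Proof. by rewrite -!scaleN1r omulZr. Qed.

Lemma omul_imagKl x y : imag_oct x -> x ** (x ** y) = - oQ x *: y.
Proof.
by move=> ix; rewrite scaleNr -omul_conjKl ix omulNl opprK.
Qed.

Lemma omul_imagKr x y : imag_oct x -> (y ** x) ** x = - oQ x *: y.
Proof.
by move=> ix; rewrite scaleNr -omul_conjKr ix omulNr opprK.
Qed.

(** Polarization in [x] of [x (x y) = - Q(x) y]. *)
Lemma omul_imag_polar x z y : imag_oct x -> imag_oct z ->
  x ** (z ** y) + z ** (x ** y) = - (2 * odot x z) *: y.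
Proof.
move=> ix iz; have := omul_imagKl y (imag_octD ix iz).
rewrite !omulDl !omulDr !omul_imagKl // => E.
apply: (addrI (- oQ x *: y)); apply: (addIr (- oQ z *: y)).
rewrite [X in X + _ = _]addrA -[LHS]addrA E -!scalerDl; congr (_ *: _).
by rewrite /odot; field.
Qed.

Lemma real_part_omul x y : imag_oct x -> imag_oct y ->
  qcoord 0 (x ** y).1 = - odot x y.
Proof. by move=> /imag_octP x0 /imag_octP y0; oct_coords; rewrite x0 y0; field. Qed.

Lemma oQ_comb k l x y :
  oQ (k *: x + l *: y) = k ^+ 2 * oQ x + l ^+ 2 * oQ y + 2 * k * l * odot x y.
Proof. by oct_coords; field. Qed.

(** * Null vectors and their annihilators *)

Lemma odot_imag_omul0 x y : imag_oct x -> imag_oct y -> x ** y = 0 -> odot x y = 0.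
Proof.
move=> ix iy xy0; apply: oppr_inj; rewrite -real_part_omul // xy0 oppr0.
by rewrite qcoordE.
Qed.

Lemma omul_anticomm x y : imag_oct x -> imag_oct y -> odot x y = 0 ->
  y ** x = - (x ** y).
Proof.
move=> ix iy xy0; have := omul_sym_imag ix iy.
rewrite xy0 scale0r => /eqP; rewrite oppr_eq0 scaler_eq0 invr_eq0 pnatr_eq0 /=.
by rewrite addr_eq0 => /eqP ->; rewrite opprK.
Qed.

Lemma omul0C x y : imag_oct x -> imag_oct y -> x ** y = 0 -> y ** x = 0.
Proof.
move=> ix iy xy0; rewrite omul_anticomm ?xy0 ?oppr0 //.
exact: odot_imag_omul0.
Qed.

Lemma null_cone_sqr x : null_cone x -> x ** x = 0.
Proof.
by move=> [ix Qx]; rewrite -{2}(omulo1 x) omul_imagKl // Qx oppr0 scale0r.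
Qed.

Lemma odotZl k x y : odot (k *: x) y = k * odot x y.
Proof.
have odot0 : odot 0 y = 0 by rewrite -(addNr y) -scaleN1r odot_linear mulN1r addNr.
by rewrite -[k *: x]addr0 odot_linear odot0 addr0.
Qed.

Lemma null_cone_comb k l x y : null_cone x -> null_cone y -> odot x y = 0 ->
  null_cone (k *: x + l *: y).
Proof.
move=> [ix Qx] [iy Qy] xy0; split; first by apply: imag_octD; apply: imag_octZ.
by rewrite oQ_comb Qx Qy xy0; ring.
Qed.

(** If [x] and [y] have zero cross product then [x ** y] is the scalar
    [- odot x y]; multiplying by [x] on the left gives
    [x (x y) = - odot x y *: x], which vanishes because [x] is null. *)
Lemma ocross_eq0 x y : null_cone x -> null_cone y ->
  ocross x y = 0 <-> x ** y = 0.
Proof.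
move=> [ix Qx] [iy Qy]; split=> [c0|xy0]; last first.
  by rewrite /ocross xy0 (omul0C ix iy xy0) subrr scaler0.
have [->|nzx] := eqVneq x 0; first exact: omul0o.
have xyE := omul_imag ix iy; rewrite c0 add0r in xyE.
have := omul_imagKl y ix.
rewrite Qx oppr0 scale0r xyE -scaleNr omulZr omulo1 => /eqP.
by rewrite scaler_eq0 (negPf nzx) orbF => /eqP ->; rewrite scale0r.
Qed.

Lemma null_cone_omul x y : null_cone x -> imag_oct y -> odot x y = 0 ->
  null_cone (x ** y).
Proof.
move=> [ix Qx] iy xy0; split; last by rewrite oQ_omul Qx mul0r.
by apply/imag_octP; rewrite real_part_omul // xy0 oppr0.
Qed.

(** The polarized identity forces [z (x y) = z (y x) = 0], while [x y + y x] is
    the scalar [- 2 odot x y], which can only annihilate [z] if it is zero. *)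
Lemma odot_common_annihilator x y z : imag_oct x -> imag_oct y -> imag_oct z ->
  z != 0 -> x ** z = 0 -> z ** y = 0 -> odot x y = 0.
Proof.
move=> ix iy iz nzz xz zy.
have zx := omul0C ix iz xz; have yz := omul0C iz iy zy.
have zxy : z ** (x ** y) = 0.
  have := omul_imag_polar y ix iz.
  by rewrite zy omulo0 add0r (odot_imag_omul0 ix iz xz) mulr0 oppr0 scale0r.
have zyx : z ** (y ** x) = 0.
  have := omul_imag_polar x iy iz.
  by rewrite zx omulo0 add0r (odot_imag_omul0 iy iz yz) mulr0 oppr0 scale0r.
have := congr1 (omul z) (omul_sym_imag ix iy).
rewrite omulNr !omulZr omulDr zxy zyx addr0 scaler0 oppr0 omulo1 => /esym/eqP.
by rewrite scaler_eq0 (negPf nzz) orbF => /eqP.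
Qed.

(** Any [x w] with [w] imaginary and orthogonal to [x] is a null vector
    annihilated by [x]. Writing [x = (a, b)], the choice [w = (0, c b)] with [c]
    an imaginary quaternion gives [x w] the first component [|b|^2 c], which is
    not proportional to [a] as soon as [c] is not. *)
Lemma null_annihilator x : null_cone x -> x != 0 ->
  exists u, [/\ null_cone u, u \notin <[x]>%VS & x ** u = 0].
Proof.
move=> Cx nzx; have [ix Qx] := Cx; have x0 := (imag_octP x).1 ix.
(* On the null cone [|a|^2 = |b|^2], so [b = 0] would force [x = 0]. *)
have Nx : qnormsq x.2 != 0.
  apply: contraNneq nzx => N2; move: (Qx); rewrite /oQ N2 subr0 => N1.
  have sum4 (a b c d : R) : a ^+ 2 + b ^+ 2 + c ^+ 2 + d ^+ 2 = 0 ->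
      [/\ a = 0, b = 0, c = 0 & d = 0].
    by move=> E; split; nra.
  have q0 (q : quat R) : qnormsq q = 0 -> q = 0.
    by move=> /sum4[? ? ? ?]; apply: quatP; rewrite !qcoord0.
  by apply/eqP/splitoctP; apply: q0.
have [c [c0 cx]] : exists c : quat R, qcoord 0 c = 0 /\ forall k, c != k *: x.1.
  (* [c = j] works if [a] is a multiple of [i], and [c = i] otherwise. *)
  have [/andP[/eqP a2 /eqP a3]|na] :=
    boolP ((qcoord 2 x.1 == 0) && (qcoord 3 x.1 == 0)).
    exists (mkquat 0 0 1 0); split=> [|k]; first by rewrite qcoordE.
    apply/eqP => /(congr1 (qcoord 2)) /eqP.
    by rewrite !qcoordE a2 mulr0 oner_eq0.
  exists (mkquat 0 1 0 0); split=> [|k]; first by rewrite qcoordE.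
  apply/eqP => E; have := congr1 (qcoord 1) E; rewrite !qcoordE.
  have := congr1 (qcoord 2) E; have := congr1 (qcoord 3) E.
  rewrite !qcoordE => /esym/eqP; rewrite mulf_eq0 => k3 /esym/eqP.
  rewrite mulf_eq0 => k2 k1; move: na k2 k3.
  have [k0 | _ /=] := eqVneq k 0; last by move=> /[swap] -> /[swap] ->.
  by move: k1 => /eqP; rewrite k0 mul0r oner_eq0.
pose w : splitoct R := (0, c * x.2).
have iw : imag_oct w by apply/imag_octP; rewrite /= qcoordE.
have xw : odot x w = 0.
  by rewrite /w; oct_coords; rewrite x0 c0; field.
have u1 : (x ** w).1 = qnormsq x.2 *: c.
  by rewrite /= mulr0 add0r -mulrA qmul_conjr qmulZr mulr1.
exists (x ** w); split; first exact: null_cone_omul.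
  apply/negP => /vlineP[k /(congr1 fst)]; rewrite u1 /= => E.
  have := cx ((qnormsq x.2)^-1 * k).
  by rewrite -scalerA -E scalerA mulVf // scale1r eqxx.
by rewrite omul_imagKl // Qx oppr0 scale0r.
Qed.

End SplitOctAlgebra.

(** * Lines and rolls *)

Section Rolling.
Variable R : realType.
Implicit Types (x y z u : splitoct R) (p q r : set (splitoct R)).

Lemma mem_proj_pt x : proj_pt x x.
Proof. by exists 1; rewrite ?oner_neq0 ?scale1r. Qed.

Lemma proj_pt_PC x : null_cone x -> x != 0 -> PC (proj_pt x).
Proof. by move=> Cx nzx; exists x. Qed.

Lemma null_subalgebra_span x y : null_cone x -> null_cone y -> x ** y = 0 ->
  null_subalgebra <<[:: x; y]>>%VS.
Proof.
move=> Cx Cy xy0; have yx0 := omul0C Cx.1 Cy.1 xy0.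
have xx0 := null_cone_sqr Cx; have yy0 := null_cone_sqr Cy.
move=> v v'; rewrite span_cons span_seq1.
move=> /memv_addP[_ /vlineP[k ->] [_ /vlineP[l ->] ->]].
move=> /memv_addP[_ /vlineP[k' ->] [_ /vlineP[l' ->] ->]].
by rewrite omulDl !omulDr !(omulZl, omulZr) xx0 xy0 yx0 yy0 !scaler0 !addr0.
Qed.

Lemma dim_span2 x y : x != 0 -> y \notin <[x]>%VS ->
  \dim <<[:: y; x]>>%VS = 2%N.
Proof.
move=> nzx yx; apply/eqP.
(* Freeness is by definition the equality of this dimension with the length. *)
by rewrite -[_ == _]/(free [:: y; x]) free_cons span_seq1 yx seq1_free.
Qed.

(** When [y] is proportional to [x] the two vectors do not span a plane; an
    independent element of the annihilator of [x] then takes the place of [y]. *)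
Lemma null_plane_through x y : null_cone x -> null_cone y -> x != 0 ->
  x ** y = 0 -> exists V : {vspace splitoct R},
    [/\ null_subalgebra V, \dim V = 2%N, x \in V & y \in V].
Proof.
move=> Cx Cy nzx xy0.
wlog yx : y Cy xy0 / y \notin <[x]>%VS => [wl|].
  have [yx|] := boolP (y \in <[x]>%VS); last exact: wl.
  have [u [Cu ux xu0]] := null_annihilator Cx nzx.
  have [V [nV dV xV _]] := wl u Cu xu0 ux.
  exists V; split=> //; have /vlineP[k ->] := yx; exact: memvZ.
exists <<[:: y; x]>>%VS; split.
- by apply: null_subalgebra_span => //; apply: omul0C; [case: Cx|case: Cy|].
- exact: dim_span2.
- by apply: memv_span; rewrite !inE eqxx orbT.
- by apply: memv_span; rewrite !inE eqxx.
Qed.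

Lemma one_rollP x y : null_cone x -> x != 0 -> null_cone y -> y != 0 ->
  at_most_rolls_away 1 (proj_pt x) (proj_pt y) <-> x ** y = 0.
Proof.
move=> Cx nzx Cy nzy; split=> [[a [a0 a1 _ aL]]|xy0].
  have [L [[V [nV _ ->]]]] := aL 0%N isT; rewrite a0 a1.
  have memV z : projectivization [set` V] (proj_pt z) -> z \in V.
    move=> [v [Vv _ zv]]; have := mem_proj_pt z; rewrite zv => -[k _ ->].
    exact: memvZ.
  by move=> /memV xV /memV yV; apply: nV.
have [V [nV dV xV yV]] := null_plane_through Cx Cy nzx xy0.
exists (fun i => if i is 0 then proj_pt x else proj_pt y); split=> //.
  by move=> [|i] _; apply: proj_pt_PC.
move=> [|//] _; exists (projectivization [set` V]).
by split; [exists V | exists x | exists y].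
Qed.

Lemma rollsS n p q :
  at_most_rolls_away n.+1 p q <->
  exists2 r, at_most_rolls_away 1 p r & at_most_rolls_away n r q.
Proof.
split=> [[a [a0 an aC aL]]|[r [a [a0 a1 aC aL]] [b [b0 bn bC bL]]]].
  exists (a 1%N).
    by exists a; split=> // i i1; [apply: aC|apply: aL]; exact: leq_trans i1 _.
  by exists (fun i => a i.+1); split=> // i /= lt_in; [apply: aC|apply: aL].
exists (fun i => if i is j.+1 then b j else p); split=> //.
  by move=> [|i] lt_in; [rewrite -a0; apply: aC|apply: bC].
by move=> [|i] lt_in; [rewrite b0 -a0 -a1; apply: aL|apply: bL].
Qed.

Lemma rolls_PC n p q : at_most_rolls_away n p q -> PC p.
Proof. by move=> [a [<- _ aC _]]; apply: aC. Qed.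

Lemma rolls_extend n x z q : null_cone x -> x != 0 -> null_cone z -> z != 0 ->
  x ** z = 0 -> at_most_rolls_away n (proj_pt z) q ->
  at_most_rolls_away n.+1 (proj_pt x) q.
Proof.
by move=> Cx nzx Cz nzz xz zq; apply/rollsS; exists (proj_pt z); rewrite ?one_rollP.
Qed.

Lemma two_rollsP x y : null_cone x -> x != 0 -> null_cone y -> y != 0 ->
  at_most_rolls_away 2 (proj_pt x) (proj_pt y) <-> odot x y = 0.
Proof.
move=> Cx nzx Cy nzy; have [ix Qx] := Cx; have [iy Qy] := Cy.
split=> [/rollsS[r xr ry]|xy0].
  have [z [[iz Qz] nzz rE]] := rolls_PC ry; subst r.
  by apply: (odot_common_annihilator ix iy iz nzz); apply/one_rollP.
(* When [x ** y = 0] it spans no point, but one roll suffices and the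
   intermediate stop may be [x] itself. *)
have [xyE|nzxy] := eqVneq (x ** y) 0.
  by apply: (rolls_extend Cx nzx Cx) => //; [apply: null_cone_sqr|apply/one_rollP].
have Cxy := null_cone_omul Cx iy xy0.
apply: (rolls_extend Cx nzx Cxy) => //.
  by rewrite omul_imagKl // Qx oppr0 scale0r.
by apply/one_rollP => //; rewrite omul_imagKr // Qy oppr0 scale0r.
Qed.

(** In the plane spanned by [x] and an independent [u] annihilated by [x], the
    combination [(u . y) x - (x . y) u] is orthogonal to [y], so it lies one
    roll from [x] and at most two rolls from [y]. *)
Lemma three_rolls x y : null_cone x -> x != 0 -> null_cone y -> y != 0 ->
  at_most_rolls_away 3 (proj_pt x) (proj_pt y).
Proof.
move=> Cx nzx Cy nzy; have [ix Qx] := Cx; have [iy Qy] := Cy.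
have [xy0|xy0] := eqVneq (odot x y) 0.
  by apply: (rolls_extend Cx nzx Cx) => //; [apply: null_cone_sqr|apply/two_rollsP].
have [u [Cu ux xu0]] := null_annihilator Cx nzx.
have xu := odot_imag_omul0 ix Cu.1 xu0.
pose z := odot u y *: x + (- odot x y) *: u.
have Cz : null_cone z by apply: null_cone_comb.
have nzz : z != 0.
  apply: contra ux; rewrite /z scaleNr subr_eq0 => /eqP E.
  apply/vlineP; exists ((odot x y)^-1 * odot u y).
  by rewrite -scalerA E scalerA mulVf // scale1r.
apply: (rolls_extend Cx nzx Cz nzz).
  by rewrite omulDr !omulZr null_cone_sqr // xu0 !scaler0 addr0.
by apply/two_rollsP => //; rewrite /z odot_linear odotZl; ring.
Qed.

End Rolling.

Theorem theorem10 (R : realType) (x y : splitoct R)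
    (Cx : null_cone x) (nzx : x != 0) (Cy : null_cone y) (nzy : y != 0) :
  [/\ (at_most_rolls_away 1 (proj_pt x) (proj_pt y) <-> x ** y = 0) /\
      (at_most_rolls_away 1 (proj_pt x) (proj_pt y) <-> ocross x y = 0),
      at_most_rolls_away 2 (proj_pt x) (proj_pt y) <-> odot x y = 0 &
      at_most_rolls_away 3 (proj_pt x) (proj_pt y)].
Proof.
split; last exact: three_rolls.
  by split; rewrite ?ocross_eq0 ?one_rollP.
exact: two_rollsP.
Qed.
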